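(* Let $\gamma<0$ and suppose that assumptions (A.1)–(A.4) of the context hold. Then, for sufficiently small $\beta>0$, the operator $T_\gamma$ is a local contraction under $\|\cdot\|_{\beta,\omega\text{-span}}$; that is, there exist functions $\beta:\mathbb{R}_+\to(0,1)$ and $L:\mathbb{R}_+\to(0,1)$ such that $$\|T_\gamma f_1-T_\gamma f_2\|_{\beta(M),\omega\text{-span}}\le L(M)\,\|f_1-f_2\|_{\beta(M),\omega\text{-span}}$$ for all $M\in\mathbb{R}_+$ and all $f_1,f_2\in C_\omega(E)$ such that $\|f_1\|_{\omega\text{-span}}\le M$ and $\|f_2\|_{\omega\text{-span}}\le M$.
   Context: Setting. $E=\mathbb{R}^d$, $U\subseteq E$ is compact, $\delta>0$ is fixed, and $X=(X_t)_{t\ge0}$ is a continuous-time Feller–Markov process with values in $E$, defined on a filtered probability space satisfying the usual conditions. $\mathbb{P}_x,\mathbb{E}_x$ denote probability and expectation for the (uncontrolled) process started at $x\in E$. The functions $f:E\to\mathbb{R}$ (reward) and $c:E\times U\to\mathbb{R}_-$ (shift cost) are given. Entropic utility: for a random variable $Z$, $\mu_x^\gamma(Z):=\frac1\gamma\ln\mathbb{E}_x[\exp(\gamma Z)]$ for $\gamma\ne0$ and $\mu^0_x(Z):=\mathbb{E}_x[Z]$. Weighted space and norms: $\omega:E\to\mathbb{R}_+$ is a fixed continuous function, and $C_\omega(E)$ is the space of continuous $g:E\to\mathbb{R}$ with $\|g\|_\omega:=\sup_{x\in E}\frac{|g(x)|}{1+\omega(x)}<\infty$. For $\beta>0$ and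 $g\in C_\omega(E)$, $$\|g\|_{\beta,\omega\text{-span}}:=\sup_{x,y\in E}\frac{g(x)-g(y)}{2+\beta\omega(x)+\beta\omega(y)},$$ and $\|g\|_{\omega\text{-span}}:=\|g\|_{1,\omega\text{-span}}$. Assumptions: (A.1) $f$ is continuous and $\|f\|_\omega<\infty$. (A.2) $c$ is continuous, there exists $c_0<0$ such that $c(x,\xi)\le c_0$ for all $x\in E$, $\xi\in U$, and $\|\hat c\|_\omega<\infty$, where $\hat c(x):=\inf_{\xi\in U}c(x,\xi)$. (A.3) There exist a constant $b_1\in(0,1)$ and finite functions $M_1,M_2:\mathbb{R}\to\mathbb{R}$ such that for all $\gamma\in\mathbb{R}$ and $x\in E$: $\mu_x^\gamma\big(\int_0^\delta\omega(X_s)\,ds\big)\le\omega(x)+M_1(\gamma)$ and $\mu_x^\gamma(\omega(X_\delta))\le b_1\omega(x)+M_2(\gamma)$. (A.4) For every $R>0$ there exist $d>0$ and a probability measure $\nu$ on $E$ with $\nu(U)>0$ such that $\inf_{x\in C_R}\mathbb{P}_x[X_\delta\in A]\ge d\,\nu(A)$ for all Borel $A\subseteq E$, where $C_R=\{x\in E:\omega(x)\le R\}$. Operators: for $\gamma<0$ and $g\in C_\omega(E)$, $$R_\gamma g(x):=\max\Big\{\mu_x^\gamma\Big(\int_0^\delta f(X_s)\,ds+g(X_\delta)\Big),\ \sup_{\xi\in U}\Big(\mu_\xi^\gamma\Big(\int_0^\delta f(X_s)\,ds+g(X_\delta)\Big)+c(x,\xi)\Big)\Big\},\quad x\in E,$$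 and $T_\gamma g(x):=\gamma\,R_\gamma(g/\gamma)(x)$. *)

(* Defs.v *)
From HB Require Import structures.
From mathcomp Require Import all_boot all_order all_algebra.
From mathcomp Require Import all_classical all_reals all_analysis.
From mathcomp Require Import measurable_realfun.
Import Order.TTheory GRing.Theory Num.Theory.
Import numFieldNormedType.Exports.

Set Implicit Arguments.
Unset Strict Implicit.
Unset Printing Implicit Defensive.

Local Open Scope classical_set_scope.
Local Open Scope ring_scope.
Local Open Scope ereal_scope.

(* R^n with its Borel sigma-algebra.  The library puts no sigma-algebra on
   'rV[R]_n itself. *)
Definition borelRn (R : realType) (n : nat) :=
  g_sigma_algebraType (@open 'rV[R]_n).

(* Time is [0, +oo[ ; values of X and F at negative times are irrelevant. *)
Record filtration (R : realType) (dW : measure_display) (W : measurableType dW)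
    (F : R -> set (set W)) : Prop := Filtration {
  filtration_sigma : forall t : R, (0 <= t)%R -> sigma_algebra [set: W] (F t) ;
  filtration_sub : forall t : R, (0 <= t)%R -> F t `<=` measurable ;
  filtration_mono : forall s t : R, (0 <= s)%R -> (s <= t)%R -> F s `<=` F t }.

(* Usual conditions for one filtration carrying a whole family of laws:
   right-continuity, and completeness with respect to the common null sets.
   Requiring F 0 to contain the null sets of each single P x would put every
   subset of [set w | X 0 w != x] in F 0 and contradict the Markov property. *)
Record usual_conditions (R : realType) (I : Type) (dW : measure_display)
    (W : measurableType dW) (F : R -> set (set W)) (P : I -> probability W R)
    : Prop := UsualConditions {
  usual_right_continuous : forall t : R, (0 <= t)%R ->
    F t = \bigcap_(s in [set s : R | (t < s)%R]) F s ;
  usual_complete : forall A N : set W, measurable A ->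
    (forall x, P x A = 0) -> N `<=` A -> F 0%R N }.

(* The Feller property is the continuity of x |-> E_x[g(X_t)] for g bounded and
   continuous; for a conservative process it follows from the invariance of
   C_0 under the semigroup, so both usual definitions are covered. *)
Record feller_markov (R : realType) (n : nat) (dW : measure_display)
    (W : measurableType dW) (F : R -> set (set W)) (X : R -> W -> 'rV[R]_n)
    (P : 'rV[R]_n -> probability W R) : Prop := FellerMarkov {
  fm_filtration : filtration F ;
  fm_usual : usual_conditions F P ;
  fm_right_continuous : forall (w : W) (t : R), (0 <= t)%R ->
    X s w @[s --> t^'+] --> X t w ;
  fm_left_limit : forall (w : W) (t : R), (0 < t)%R ->
    cvg (X s w @[s --> t^'-]) ;
  fm_adapted : forall (t : R) (A : set (borelRn R n)), (0 <= t)%R ->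
    measurable A -> F t (X t @^-1` A) ;
  fm_start : forall x : 'rV[R]_n, P x [set w | X 0%R w = x] = 1 ;
  fm_measurable : forall (t : R) (A : set (borelRn R n)), (0 <= t)%R ->
    measurable A ->
    measurable_fun [set: borelRn R n] (fun x : borelRn R n => P x (X t @^-1` A)) ;
  (* P_x[X_(t+s) \in A | F_t] = P_(X_t)[X_s \in A] almost surely *)
  fm_markov : forall (x : 'rV[R]_n) (s t : R) (A : set (borelRn R n)) (B : set W),
    (0 <= s)%R -> (0 <= t)%R -> measurable A -> F t B ->
    P x (B `&` (X (t + s)%R @^-1` A)) = \int[P x]_(w in B) P (X t w) (X s @^-1` A) ;
  fm_feller : forall (t : R) (g : 'rV[R]_n -> R), (0 <= t)%R -> continuous g ->
    (exists K : R, forall x, (`|g x| <= K)%R) ->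
    continuous (fun x => 'E_(P x)[fun w => g (X t w)]) }.

Definition entropic (R : realType) (dW : measure_display) (W : measurableType dW)
    (P : probability W R) (gamma : R) (Z : W -> R) : \bar R :=
  if gamma == 0%R then 'E_P[Z]
  else (gamma^-1)%:E * lne 'E_P[fun w => expR (gamma * Z w)%R].

(* The norms are extended-real valued, and defined on extended-real valued
   functions, so that an infinite value is never read as a real number. *)
Definition wnorm (R : realType) (n : nat) (omega : 'rV[R]_n -> R)
    (g : 'rV[R]_n -> \bar R) : \bar R :=
  ereal_sup [set `|g x| * ((1 + omega x)^-1)%:E | x in [set: 'rV[R]_n]].

Definition wspan (R : realType) (n : nat) (omega : 'rV[R]_n -> R) (beta : R)
    (g : 'rV[R]_n -> \bar R) : \bar R :=
  ereal_sup [set (g z.1 - g z.2)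
                   * ((2 + beta * omega z.1 + beta * omega z.2)^-1)%:E
            | z in [set: 'rV[R]_n * 'rV[R]_n]].

Definition Cw (R : realType) (n : nat) (omega : 'rV[R]_n -> R)
    (g : 'rV[R]_n -> R) : Prop :=
  continuous g /\ wnorm omega (EFin \o g) < +oo.

Definition path_integral (R : realType) (n : nat) (W : Type)
    (X : R -> W -> 'rV[R]_n) (delta : R) (f : 'rV[R]_n -> R) (w : W) : R :=
  (\int[lebesgue_measure]_(s in `[0%R, delta]) f (X s w))%R.

Definition R_op (R : realType) (n : nat) (dW : measure_display)
    (W : measurableType dW) (X : R -> W -> 'rV[R]_n)
    (P : 'rV[R]_n -> probability W R) (U : set 'rV[R]_n) (delta : R)
    (f : 'rV[R]_n -> R) (c : 'rV[R]_n -> 'rV[R]_n -> R) (gamma : R)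
    (g : 'rV[R]_n -> R) (x : 'rV[R]_n) : \bar R :=
  let v y := entropic (P y) gamma
    (fun w => path_integral X delta f w + g (X delta w))%R in
  maxe (v x) (ereal_sup [set v xi + (c x xi)%:E | xi in U]).

Definition T_op (R : realType) (n : nat) (dW : measure_display)
    (W : measurableType dW) (X : R -> W -> 'rV[R]_n)
    (P : 'rV[R]_n -> probability W R) (U : set 'rV[R]_n) (delta : R)
    (f : 'rV[R]_n -> R) (c : 'rV[R]_n -> 'rV[R]_n -> R) (gamma : R)
    (g : 'rV[R]_n -> R) (x : 'rV[R]_n) : \bar R :=
  gamma%:E * R_op X P U delta f c gamma (fun y => g y / gamma)%R x.

Definition assumption_A1 (R : realType) (n : nat) (omega f : 'rV[R]_n -> R)
    : Prop := Cw omega f.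

(* c is only meaningful on E x U; its second argument ranges over all of E for
   typing reasons. *)
Definition assumption_A2 (R : realType) (n : nat) (omega : 'rV[R]_n -> R)
    (U : set 'rV[R]_n) (c : 'rV[R]_n -> 'rV[R]_n -> R) : Prop :=
  [/\ {within [set: 'rV[R]_n] `*` U, continuous (fun z => c z.1 z.2)},
      exists2 c0 : R, (c0 < 0)%R & forall x xi, U xi -> (c x xi <= c0)%R
    & wnorm omega (fun x => ereal_inf [set (c x xi)%:E | xi in U]) < +oo].

Definition assumption_A3 (R : realType) (n : nat) (dW : measure_display)
    (W : measurableType dW) (X : R -> W -> 'rV[R]_n)
    (P : 'rV[R]_n -> probability W R) (delta : R) (omega : 'rV[R]_n -> R)
    : Prop :=
  exists (b1 : R) (M1 M2 : R -> R), (0 < b1 < 1)%R /\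
    forall (gamma : R) (x : 'rV[R]_n),
      entropic (P x) gamma (path_integral X delta omega)
        <= (omega x + M1 gamma)%:E /\
      entropic (P x) gamma (fun w => omega (X delta w))
        <= (b1 * omega x + M2 gamma)%:E.

Definition assumption_A4 (R : realType) (n : nat) (dW : measure_display)
    (W : measurableType dW) (X : R -> W -> 'rV[R]_n)
    (P : 'rV[R]_n -> probability W R) (U : set 'rV[R]_n) (delta : R)
    (omega : 'rV[R]_n -> R) : Prop :=
  forall r : R, (0 < r)%R ->
    exists (d : R) (nu : probability (borelRn R n) R),
      [/\ (0 < d)%R, 0 < nu U &
          forall A : set (borelRn R n), measurable A ->
            d%:E * nu A <= ereal_inf [set P x (X delta @^-1` A)
                                     | x in [set x | (omega x <= r)%R]]].

(* Main.v *)
Require Import Defs.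
From HB Require Import structures.
From mathcomp Require Import all_boot all_order all_algebra.
From mathcomp Require Import all_classical all_reals all_analysis.
From mathcomp Require Import measurable_realfun.
From mathcomp Require Import ring lra.
Import Order.TTheory GRing.Theory Num.Theory.
Import numFieldNormedType.Exports.
Local Open Scope classical_set_scope.
Local Open Scope ring_scope.

(** Write Y_g = gamma * int_0^delta f(X_s) ds + g(X_delta) and
    V_g(a) = ln E_a[exp Y_g].  Multiplying by gamma < 0 turns the maximum that
    defines the operator into a minimum, so T g(x) is the infimum of
    V_g(a) + cost over the options a = x (at cost 0) and a in U (at cost
    gamma * c(x,a)).  Options and costs do not depend on g; hence the span of
    T f1 - T f2 between x and y is controlled by
      (V_f1(a) - V_f2(a)) - (V_f1(e) - V_f2(e)),   a an option at x, e one at y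
    (lub_cross).

    Put h = f1 - f2.  By Jensen's inequality V_f1(a) - V_f2(a) is at most the
    mean of h(X_delta) under the law with density exp Y_f1 / E_a[exp Y_f1], and
    V_f1(e) - V_f2(e) is at least its mean under the law at e tilted by Y_f2
    (tilt_compare).  It remains to compare two tilted laws of X_delta on a
    function with |h - kappa| <= s (1 + beta omega), which is the weighted-norm
    form of Harris' theorem due to Hairer and Mattingly.  Two inputs are needed.

    - Drift (tilt_drift): the tilted mean of omega(X_delta) is at most
      b omega(a) + K with b < 1.  Bounding it by 1/lam times the logarithm of
      the tilted mean of exp(lam omega(X_delta)), the tilt contributes a slope
      independent of lam, which division by lam makes negligible; the hypothesis
      on exponential moments of every order makes every lam admissible.

    - Minorization (tilt_minorization): since the tilt sees the whole path, the
      tilted law of X_delta need not dominate a multiple of nu.  But for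
      omega(a) bounded, an event of probability at least p keeps a tilted
      probability at least eps(p) > 0, and this is enough: one of the sets
      {h <= kappa}, {h >= kappa} has nu-mass at least 1/2, hence a definite
      mass under the corresponding tilted law, on which h gives no positive
      (respectively negative) contribution.

    For omega(x) + omega(y) large the drift alone contracts; otherwise the
    minorization gains eps, and a small beta keeps the weight from spoiling this
    gain (contraction_constants).  All constants depend on f1 and f2 only
    through the bound M on their spans.

    Tilted means are handled as linear functionals of positive measurable
    weights, so the path integrals have to be measurable and finite; this is
    where the cadlag property of the paths enters. *)

(** * Cadlag paths and the measurability of path integrals *)

Section CadlagPaths.
Variable R : realType.
Implicit Types (u : R -> R).

(** One-sided limits bound a path near each time, and finitely many such
    neighbourhoods cover a compact interval.  Without boundedness the real
    integral of a path could silently be the default value 0. *)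
Lemma cadlag_bounded u (a : R) :
  (forall t, 0 <= t -> u s @[s --> t^'+] --> u t) ->
  (forall t, 0 < t -> cvg (u s @[s --> t^'-])) ->
  exists K, forall s, 0 <= s <= a -> `|u s| <= K.
Proof.
move=> ru lu.
have near_bounded (F : set_system R) (FF : ProperFilter F) (l : R) :
    u s @[s --> F] --> l -> exists K, \forall s \near F, `|u s| <= K.
  move=> ul; exists (`|l| + 1).
  have /cvgrPdist_le /(_ 1 ltr01) := ul; apply: filterS => s ls.
  by have := ler_normD l (u s - l); rewrite addrC subrK; move: ls; rewrite distrC; lra.
have [K HK] : exists K, `[0, a] `<=` (fun s => 0 <= s -> `|u s| <= K).
  have : \forall K \near +oo, `[0, a] `<=` (fun s => 0 <= s -> `|u s| <= K).
    have /compact_near_coveringP/near_covering_withinP := @segment_compact R 0 a.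
    apply => t /=; rewrite in_itv/= => /andP[t0 ta].
    have [Kr /= Hr] := near_bounded _ _ _ (ru t t0).
    have [Kl Hl] : exists K, \forall s \near t^'-, 0 <= s -> `|u s| <= K.
      move: t0; rewrite le_eqVlt => /predU1P[<-|t0].
        exists 0; near=> s => s0; suff : s < 0 by rewrite ltNge s0.
        by near: s; exact: nbhs_left_lt.
      have /cvg_ex [l ul] := lu t t0.
      have [K HK] := near_bounded _ _ _ ul.
      by exists K; apply: filterS HK.
    pose M := Num.max (Num.max Kr Kl) `|u t|.
    have nt : \forall s \near t, 0 <= s -> `|u s| <= M.
      move: Hr Hl; rewrite /at_right /at_left !near_withinE => Hr Hl.
      near=> s => s0; rewrite /M !le_max.
      have [st|ts|->] := ltgtP s t.
      - by rewrite (near Hl s)// orbT.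
      - by rewrite (near Hr s).
      - by rewrite lexx orbT.
    exists ([set s | 0 <= s -> `|u s| <= M], [set K | M <= K]) => /=.
      split => //; exists M; split; first exact: num_real.
      by move=> x /ltW.
    by move=> [s K] /= [us MK] _ s0; apply: le_trans MK; exact: us.
  by move=> /filter_ex[K HK]; exists K.
exists K => s /andP[s0 sa]; apply: (HK s) => //=; by rewrite in_itv/= s0 sa.
Unshelve. all: by end_near. Qed.

End CadlagPaths.

Section PathMeasurability.
Context {R : realType} {d : measure_display} {W : measurableType d}.
Variables (u : R -> W -> R) (a : R).
Hypothesis u_measurable : forall t, 0 <= t -> measurable_fun setT (u t).
Hypothesis u_right : forall w t, 0 <= t -> u s w @[s --> t^'+] --> u t w.

(* The first point of the lattice with mesh 1/(k+1) strictly after s: strictly,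
   because only limits from the right are available. *)
Let grid (k : nat) (s : R) : R := (Num.trunc (s * k.+1%:R)).+1%:R / k.+1%:R.

Let grid_gt k s : 0 <= s -> s < grid k s.
Proof. by move=> s0; rewrite /grid ltr_pdivlMr ?ltr0n// truncnS_gt. Qed.

Let grid_le k s : 0 <= s -> grid k s <= s + k.+1%:R^-1.
Proof.
move=> s0; rewrite /grid -addn1 natrD mulrDl mul1r lerD2r ler_pdivrMr ?ltr0n//.
by have /andP[] := truncn_itv (mulr_ge0 s0 (ler0n R k.+1)).
Qed.

Let grid_cvg s : 0 <= s -> grid k s @[k --> \oo] --> s.
Proof.
move=> s0; apply: (@squeeze_cvgr _ _ _ _ (cst s) (fun k => s + k.+1%:R^-1)).
- by apply: nearW => k; rewrite (ltW (grid_gt k s s0)) grid_le.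
- exact: cvg_cst.
- rewrite -[X in _ --> X]addr0; apply: cvgD; first exact: cvg_cst.
  exact: cvg_harmonic.
Qed.

(** A right-continuous process is the pointwise limit of the processes frozen at
    the next lattice point, each of which takes countably many time values. *)
Lemma right_continuous_measurable_prod :
  measurable_fun (`[0, a]%classic `*` setT : set (measurableTypeR R * W))
    (fun z => u z.1 z.2).
Proof.
have mD : measurable (`[0, a]%classic `*` setT : set (measurableTypeR R * W)).
  by apply: measurableX => //; exact: measurable_itv.
apply: (@measurable_fun_cvg _ _ _ _ (fun k z => u (grid k z.1) z.2)); last first.
  move=> [s w] [/= + _]; rewrite in_itv/= => /andP[s0 _].
  have /cvg_at_rightP := u_right w s s0; apply; split.
    by move=> k; exact: grid_gt.
  exact: grid_cvg.
move=> k _ B mB.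
rewrite [X in measurable X](_ : _ = \bigcup_j
  ((`[0, a]%classic `&` `[j%:R / k.+1%:R, j.+1%:R / k.+1%:R[%classic) `*`
   (u (j.+1%:R / k.+1%:R) @^-1` B))); last first.
  apply/seteqP; split=> [[s w] [[/= + _]]|[s w] [j _] /= [[]]].
    rewrite in_itv/= => /andP[s0 sa] Bu.
    exists (Num.trunc (s * k.+1%:R)) => //=; split => //; split.
      by rewrite in_itv/= s0 sa.
    have /andP[h1 h2] := truncn_itv (mulr_ge0 s0 (ler0n R k.+1)).
    by rewrite in_itv/= ler_pdivrMr ?ltr0n// h1 ltr_pdivlMr ?ltr0n.
  move=> sa; rewrite in_itv/= => /andP[js sj] Bu.
  have /andP[s0 sa'] : 0 <= s <= a by move: sa; rewrite in_itv.
  split.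
    by [].
  rewrite /= /grid (@truncn_def _ _ j) //.
  by rewrite -ler_pdivrMr ?ltr0n// -ltr_pdivlMr ?ltr0n// js sj.
apply: bigcupT_measurable => j; apply: measurableX.
  by apply: measurableI; exact: measurable_itv.
have h : (0:R) <= j.+1%:R / k.+1%:R by rewrite divr_ge0 ?ler0n.
by have := u_measurable _ h measurableT _ mB; rewrite setTI.
Qed.

Lemma measurable_path_integral_ge0 :
  (forall t w, 0 <= u t w) ->
  measurable_fun setT
    (fun w => \int[lebesgue_measure]_(s in `[0, a]) u s w).
Proof.
move=> u0; rewrite /Rintegral; apply: measurableT_comp => //.
pose D : set (measurableTypeR R * W) := `[0, a]%classic `*` setT.
have mD : measurable D by apply: measurableX => //; exact: measurable_itv.
pose f := (fun z : measurableTypeR R * W => (u z.1 z.2)%:E) \_ D.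
have mf : measurable_fun setT f.
  apply: (iffLR (measurable_restrictT _ mD)).
  have /measurable_EFinP h := right_continuous_measurable_prod; exact: h.
have f0 z : (0 <= f z)%E by rewrite /f patchE; case: ifPn => // _; rewrite lee_fin.
have := @measurable_fun_fubini_tonelli_G _ _ _ _ _ (@lebesgue_measure R) f mf f0.
apply: eq_measurable_fun => w _; rewrite /fubini_G [RHS]integral_mkcond.
apply: eq_integral => s _; rewrite /f !patchE.
rewrite (_ : ((s, w) \in D) = (s \in `[0, a]%classic))//.
by apply/idP/idP => [/set_mem[]|/set_mem]; rewrite inE//.
Qed.

End PathMeasurability.

Section PathIntegrals.
Context {R : realType} {n : nat} {dW : measure_display} {W : measurableType dW}.
Context {F : R -> set (set W)} {X : R -> W -> 'rV[R]_n}.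
Context {P : 'rV[R]_n -> probability W R}.
Hypothesis hX : feller_markov F X P.
Implicit Types g : 'rV[R]_n -> R.

Lemma measurable_preimage_process t (A : set (borelRn R n)) :
  0 <= t -> measurable A -> measurable (X t @^-1` A).
Proof.
move=> t0 mA; apply: (filtration_sub (fm_filtration hX) t0).
exact: (fm_adapted hX t0 mA).
Qed.

Lemma continuous_borel_preimage g (B : set R) :
  continuous g -> measurable B -> measurable (g @^-1` B : set (borelRn R n)).
Proof.
move=> cg mB; have mg : measurable_fun (setT : set (borelRn R n)) g.
  apply: (measurability _ (RGenOpens.measurableE R)) => //.
  move=> _ [_ [a [b ->] <-]]; rewrite setTI; apply: sub_sigma_algebra.
  by apply: open_comp => //; move=> x _; exact: cg.
by have := mg measurableT _ mB; rewrite setTI.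
Qed.

Lemma measurable_sublevel g1 g2 (b : R) : continuous g1 -> continuous g2 ->
  measurable ([set x | g1 x - g2 x <= b] : set (borelRn R n)).
Proof.
move=> c1 c2; have -> : [set x | g1 x - g2 x <= b] =
    (fun x => g1 x - g2 x) @^-1` `]-oo, b]%classic.
  by apply/seteqP; split=> x; rewrite /= in_itv.
apply: continuous_borel_preimage => //.
by move=> x; apply: continuousB; [exact: c1|exact: c2].
Qed.

Lemma measurable_process t g : 0 <= t -> continuous g ->
  measurable_fun setT (fun w => g (X t w)).
Proof.
move=> t0 cg _ B mB; rewrite setTI.
apply: (measurable_preimage_process t (g @^-1` B) t0).
exact: continuous_borel_preimage.
Qed.

Let right_continuous_path g : continuous g ->
  forall w t, 0 <= t -> g (X s w) @[s --> t^'+] --> g (X t w).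
Proof.
move=> cg w t t0; apply: continuous_cvg; first exact: cg.
exact: (fm_right_continuous hX).
Qed.

Lemma integrable_path (a : R) g w : continuous g ->
  lebesgue_measure.-integrable `[0, a] (EFin \o (fun s => g (X s w))).
Proof.
move=> cg; apply: measurable_bounded_integrable => //.
- by rewrite /= lebesgue_measure_itv/=; case: ifP => // _; rewrite -EFinB ltry.
- apply: (@measurable_comp _ _ _ _ _ _ (`[0, a]%classic `*` setT)
      (fun z : measurableTypeR R * W => g (X z.1 z.2)) _ (fun s => (s, w))) => //=.
  + by apply: measurableX => //; exact: measurable_itv.
  + by move=> _ [s /= sa <-].
  + apply: (right_continuous_measurable_prod (fun s w => g (X s w))).
      by move=> t t0; exact: measurable_process.
    exact: right_continuous_path.
  + exact/measurable_funTS/measurable_pair2.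
- have [K HK] : exists K, forall s, 0 <= s <= a -> `|g (X s w)| <= K.
    apply: cadlag_bounded; first by move=> t; exact: right_continuous_path.
    move=> t t0; have /cvg_ex [l Xl] : cvg (X s w @[s --> t^'-]) by exact: (fm_left_limit hX).
    apply/cvg_ex; exists (g l); apply: continuous_cvg => //; exact: cg.
  rewrite /bounded_near; near=> M; move=> s /=; rewrite in_itv/= => /HK h.
  by apply: (le_trans h); near: M; apply: nbhs_pinfty_ge; exact: num_real.
Unshelve. all: by end_near. Qed.

Lemma path_integral_ge0 a g w : (forall x, 0 <= g x) ->
  0 <= path_integral X a g w.
Proof. by move=> g0; apply: Rintegral_ge0. Qed.

(** Tonelli gives the claim for nonnegative functions; g is the difference of
    the nonnegative continuous functions |g| and |g| - g. *)
Lemma measurable_path_integral a g : continuous g ->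
  measurable_fun setT (path_integral X a g).
Proof.
move=> cg; pose gp x : R := `|g x|; pose gq x : R := `|g x| - g x.
have cgp : continuous gp.
  by move=> x; apply: continuous_comp; [exact: cg|exact: norm_continuous].
have cgq : continuous gq by move=> x; exact: (cvgB (cgp x) (cg x)).
have -> : path_integral X a g =
    fun w => path_integral X a gp w - path_integral X a gq w.
  apply/funext => w; rewrite /path_integral -RintegralB//=; last 2 first.
    exact: integrable_path.
    exact: integrable_path.
  by apply: eq_Rintegral => s _; rewrite /gp /gq; lra.
have m (h : 'rV[R]_n -> R) : continuous h -> (forall x, 0 <= h x) ->
    measurable_fun setT (path_integral X a h).
  move=> ch h0; apply: (measurable_path_integral_ge0 (fun s w => h (X s w))) => //.
    by move=> t t0; exact: measurable_process.
  exact: right_continuous_path.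
apply: measurable_funB; apply: m => // x; by rewrite ?subr_ge0 ?normr_ge0 ?ler_norm.
Qed.

Lemma path_integral_le_weight (a K : R) (omega : 'rV[R]_n -> R) g w :
  0 <= a -> 0 <= K -> continuous omega -> continuous g ->
  (forall x, `|g x| <= K * (1 + omega x)) ->
  `|path_integral X a g w| <= K * (a + path_integral X a omega w).
Proof.
move=> a0 K0 co cg gK; rewrite /path_integral.
apply: (le_trans (le_normr_Rintegral _ _)) => //; first exact: integrable_path.
have ci : continuous (fun x => 1 + omega x).
  by move=> x; apply: continuousD; [exact: cst_continuous|exact: co].
have cK : continuous (fun x => K * (1 + omega x)).
  by move=> x; exact: (cvgMl_tmp (ci x)).
apply: (@le_trans _ _ (\int[lebesgue_measure]_(s in `[0, a]) (K * (1 + omega (X s w))))).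
  apply: le_Rintegral => //.
  - apply: (integrable_path a (fun x => `|g x|)) => x.
    by apply: continuous_comp; [exact: cg|exact: norm_continuous].
  - exact: (integrable_path a (fun x => K * (1 + omega x))).
rewrite RintegralZl//; last exact: (integrable_path a (fun x => 1 + omega x)).
rewrite RintegralD//; last 2 first.
- by apply: (integrable_path a (fun=> 1) w) => x; exact: cst_continuous.
- exact: integrable_path.
rewrite Rintegral_cst//= lebesgue_measure_itv/= lte_fin.
by rewrite mul1r; case: ltgtP a0 => //= [_|<-] _; rewrite ?subr0.
Qed.

End PathIntegrals.

(** * Jensen's inequality and exponential moments *)

Section Tilting.
Context {R : realType} {d : measure_display} {W : measurableType d}.
Variable P : probability W R.
Local Notation "'E phi" := (Rintegral P setT phi) (at level 10, phi at level 8).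
Local Notation intg phi := (P.-integrable setT (EFin \o phi)).

Lemma mean_mono (phi psi : W -> R) : intg phi -> intg psi ->
  (forall w, phi w <= psi w) -> 'E phi <= 'E psi.
Proof. by move=> ip iq pq; apply: le_Rintegral. Qed.

Lemma mean_cst (c : R) : 'E (fun=> c) = c.
Proof. by rewrite Rintegral_cst//= probability_setT mulr1. Qed.

Lemma meanZ c (phi : W -> R) : intg phi -> 'E (fun w => c * phi w) = c * 'E phi.
Proof. by move=> ip; apply: RintegralZl. Qed.

Lemma meanD (phi psi : W -> R) : intg phi -> intg psi ->
  'E (fun w => phi w + psi w) = 'E phi + 'E psi.
Proof. by move=> ip iq; apply: RintegralD. Qed.

Lemma mean_integrableZ c (phi : W -> R) : intg phi -> intg (fun w => c * phi w).
Proof. by move=> ip; apply: (@integrableZl _ _ _ P setT measurableT c (EFin \o phi)). Qed.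

Lemma mean_integrableD (phi psi : W -> R) : intg phi -> intg psi ->
  intg (fun w => phi w + psi w).
Proof. by move=> ip iq; apply: (integrableD measurableT ip iq). Qed.

Lemma mean_integrable_le (phi psi : W -> R) : measurable_fun setT phi ->
  (forall w, `|phi w| <= psi w) -> intg psi -> intg phi.
Proof.
move=> mp pq iq; apply: le_integrable iq => //; first exact/measurable_EFinP.
by move=> w _; rewrite /= lee_fin (le_trans (pq w))// ler_norm.
Qed.

Lemma expR_tangent (m t : R) : expR m * (1 + t - m) <= expR t.
Proof.
have -> : t = m + (t - m) by ring.
rewrite expRD ler_pM2l ?expR_gt0//.
have := expR_ge1Dx (t - m); lra.
Qed.

(** Jensen's inequality for an unnormalized weight rho, in the two forms
    exp(mean) <= mean(exp) and mean <= ln(mean(exp)).  Both come from the tangent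
    line of exp at m, which avoids constructing the tilted measure. *)
Lemma weighted_jensen_ge (rho phi : W -> R) (m : R) :
  (forall w, 0 <= rho w) -> intg rho -> intg (fun w => rho w * phi w) ->
  intg (fun w => rho w * expR (phi w)) ->
  m * 'E rho <= 'E (fun w => rho w * phi w) ->
  expR m * 'E rho <= 'E (fun w => rho w * expR (phi w)).
Proof.
move=> rho0 ir irp ire H.
apply: (@le_trans _ _ ('E (fun w => expR m * ((1 - m) * rho w + rho w * phi w)))).
  rewrite meanZ; last by apply: mean_integrableD => //; exact: mean_integrableZ.
  rewrite meanD//; last exact: mean_integrableZ.
  rewrite meanZ// ler_pM2l ?expR_gt0//.
  move: H; set a := 'E rho; set b := 'E _; lra.
apply: mean_mono => //; first by apply: mean_integrableZ; apply: mean_integrableD => //; exact: mean_integrableZ.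
move=> w; have := ler_wpM2l (rho0 w) (expR_tangent m (phi w)).
by congr (_ <= _); ring.
Qed.

Lemma weighted_jensen_le (rho phi : W -> R) (m : R) :
  (forall w, 0 <= rho w) -> intg rho -> intg (fun w => rho w * phi w) ->
  intg (fun w => rho w * expR (phi w)) ->
  'E (fun w => rho w * expR (phi w)) <= expR m * 'E rho ->
  'E (fun w => rho w * phi w) <= m * 'E rho.
Proof.
move=> rho0 ir irp ire H.
apply: (@le_trans _ _ ('E (fun w => expR (- m) * (rho w * expR (phi w))
                                    + (m - 1) * rho w))).
  apply: mean_mono => //; first by apply: mean_integrableD; exact: mean_integrableZ.
  move=> w; have := ler_wpM2l (rho0 w) (expR_tangent m (phi w)).
  rewrite -(@ler_pM2l _ (expR (- m))) ?expR_gt0//.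
  have e : expR (- m) * expR m = 1 by rewrite -expRD addNr expR0.
  set x := expR (phi w).
  have -> : expR (- m) * (rho w * (expR m * (1 + phi w - m))) =
    (expR (- m) * expR m) * (rho w * (1 + phi w - m)) by ring.
  by rewrite e mul1r; lra.
rewrite meanD; try exact: mean_integrableZ.
rewrite !meanZ//.
have : expR (- m) * 'E (fun w => rho w * expR (phi w)) <= 'E rho.
  rewrite -(@ler_pM2l _ (expR m)) ?expR_gt0// mulrA -expRD subrr expR0 mul1r.
  exact: H.
set a := 'E rho; set b := expR _ * _; lra.
Qed.

(** The entropic utility is extended-real valued, so a real upper bound on it
    already forces the exponential moment to be finite. *)
Lemma entropic_exp_moment (l m : R) (Z : W -> R) : 0 < l ->
  measurable_fun setT Z -> (entropic P l Z <= m%:E)%E ->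
  intg (fun w => expR (l * Z w)) /\ 'E (fun w => expR (l * Z w)) <= expR (l * m).
Proof.
move=> l0 mZ; rewrite /entropic gt_eqF// unlock.
set J := (\int[P]_w _)%E.
have mE : measurable_fun setT (fun w => expR (l * Z w)).
  by apply: measurableT_comp => //; apply: measurable_funM.
have J0 : (0 <= J)%E by apply: integral_ge0 => w _; rewrite lee_fin expR_ge0.
move=> H; have Jm : (J <= (expR (l * m))%:E)%E.
  move: H J0; case: J => [r| |]//=.
  - case: ifPn => [r0 _ _|r0].
      by rewrite lee_fin (le_trans r0)// expR_ge0.
    rewrite -ltNge in r0; rewrite -EFinM !lee_fin ler_pdivrMl// => H _.
    by rewrite -[leLHS](lnK r0) ler_expR.
  - by rewrite gt0_muley// lte_fin invr_gt0.
have fJ : J \is a fin_num by rewrite ge0_fin_numE// (le_lt_trans Jm)// ltry.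
split.
  apply/integrableP; split; first exact/measurable_EFinP.
  rewrite (eq_integral (fun w => (expR (l * Z w))%:E)); last first.
    by move=> w _; rewrite /= ger0_norm ?expR_ge0.
  by rewrite -ge0_fin_numE.
by rewrite -lee_fin /Rintegral fineK.
Qed.

(** The Cauchy-Schwarz inequality for exponentials, by integrating
    2 exp(p - a) exp(q - b) <= exp(2 (p - a)) + exp(2 (q - b)). *)
Lemma exp_moment_add (p q : W -> R) (a b : R) :
  measurable_fun setT p -> measurable_fun setT q ->
  intg (fun w => expR (2 * p w)) -> intg (fun w => expR (2 * q w)) ->
  'E (fun w => expR (2 * p w)) <= expR (2 * a) ->
  'E (fun w => expR (2 * q w)) <= expR (2 * b) ->
  intg (fun w => expR (p w + q w)) /\
  'E (fun w => expR (p w + q w)) <= expR (a + b).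
Proof.
move=> mp mq ip iq Ep Eq.
have ineq w : expR (p w + q w) <= expR (b - a) / 2 * expR (2 * p w)
                                  + expR (a - b) / 2 * expR (2 * q w).
  have e1 : expR (b - a) * expR (2 * p w) = expR (a + b) * expR (p w - a) ^+ 2.
    by rewrite expr2 -!expRD; congr expR; ring.
  have e2 : expR (a - b) * expR (2 * q w) = expR (a + b) * expR (q w - b) ^+ 2.
    by rewrite expr2 -!expRD; congr expR; ring.
  have e3 : expR (p w + q w) = expR (a + b) * (expR (p w - a) * expR (q w - b)).
    by rewrite -!expRD; congr expR; ring.
  rewrite [X in _ <= X + _]mulrAC e1 [X in _ <= _ + X]mulrAC e2 e3.
  have := mulr_ge0 (expR_ge0 (a + b)) (sqr_ge0 (expR (p w - a) - expR (q w - b))).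
  by lra.
have ib : intg (fun w => expR (b - a) / 2 * expR (2 * p w)
                         + expR (a - b) / 2 * expR (2 * q w)).
  by apply: mean_integrableD; exact: mean_integrableZ.
have ipq : intg (fun w => expR (p w + q w)).
  apply: (mean_integrable_le _ _ _ _ ib).
    by apply: measurableT_comp => //; exact: measurable_funD.
  by move=> w; rewrite ger0_norm ?expR_ge0.
split => //; apply: (le_trans (mean_mono _ _ ipq ib ineq)).
rewrite meanD; try exact: mean_integrableZ.
rewrite !meanZ//.
have h1 : expR (b - a) * 'E (fun w => expR (2 * p w)) <= expR (a + b).
  rewrite (_ : expR (a + b) = expR (b - a) * expR (2 * a)).
    by rewrite ler_pM2l ?expR_gt0.
  by rewrite -expRD; congr expR; ring.
have h2 : expR (a - b) * 'E (fun w => expR (2 * q w)) <= expR (a + b).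
  rewrite (_ : expR (a + b) = expR (a - b) * expR (2 * b)).
    by rewrite ler_pM2l ?expR_gt0.
  by rewrite -expRD; congr expR; ring.
move: h1 h2; set x := 'E _; set y := 'E _; lra.
Qed.

End Tilting.

Section Subexponential.
Context {R : realType} {d : measure_display} {W : measurableType d}.
Context {P : probability W R} {S : W -> R}.
Local Notation intg phi := (P.-integrable setT (EFin \o phi)).

(** Integrands are sorted by their growth in a size variable S with exponential
    moments of every order: exp_growth is closed under products, contains the
    exponentials of linear_growth, and implies integrability. *)
Definition linear_growth (phi : W -> R) : Prop :=
  measurable_fun setT phi /\ exists C, forall w, `|phi w| <= C * (1 + S w).

Definition exp_growth (phi : W -> R) : Prop :=
  measurable_fun setT phi /\ exists C, forall w, `|phi w| <= expR (C * (1 + S w)).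

Lemma exp_growthM {phi psi : W -> R} : exp_growth phi -> exp_growth psi ->
  exp_growth (fun w => phi w * psi w).
Proof.
move=> [mp [C hC]] [mq [D hD]]; split; first exact: measurable_funM.
by exists (C + D) => w; rewrite normrM mulrDl expRD ler_pM.
Qed.

Lemma linear_exp_growth {phi : W -> R} : linear_growth phi -> exp_growth phi.
Proof.
move=> [mp [C hC]]; split => //; exists C => w; apply: (le_trans (hC w)).
have := expR_ge1Dx (C * (1 + S w)); lra.
Qed.

Lemma exp_growth_expR {phi : W -> R} : linear_growth phi ->
  exp_growth (fun w => expR (phi w)).
Proof.
move=> [mp [C hC]]; split; first exact: measurableT_comp.
exists C => w; rewrite ger0_norm ?expR_ge0// ler_expR.
exact: le_trans (ler_norm _) (hC w).
Qed.

Lemma exp_growth_indic (A : set W) : measurable A -> exp_growth \1_A.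
Proof.
move=> mA; split; first exact: measurable_indic.
exists 0 => w; rewrite mul0r expR0 indicE normr_nat.
by case: (w \in A); rewrite ?lexx ?ler01.
Qed.

Lemma linear_growthD {phi psi : W -> R} : linear_growth phi -> linear_growth psi ->
  linear_growth (fun w => phi w + psi w).
Proof.
move=> [mp [C hC]] [mq [D hD]]; split; first exact: measurable_funD.
by exists (C + D) => w; rewrite mulrDl (le_trans (ler_normD _ _))// lerD.
Qed.

Lemma linear_growthZ (c : R) {phi : W -> R} : linear_growth phi ->
  linear_growth (fun w => c * phi w).
Proof.
move=> [mp [C hC]]; split; first exact: measurable_funM.
by exists (`|c| * C) => w; rewrite normrM -mulrA ler_wpM2l.
Qed.

Hypothesis S0 : forall w, 0 <= S w.
Hypothesis iS : forall C, 0 < C -> intg (fun w => expR (C * (1 + S w))).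

Lemma linear_growth_cst (c : R) : linear_growth (fun=> c).
Proof.
split; first exact: measurable_cst.
by exists `|c| => w; rewrite ler_peMr// lerDl.
Qed.

Lemma exp_growth_integrable {phi : W -> R} : exp_growth phi -> intg phi.
Proof.
move=> [mphi [C hC]].
have C0 : 0 < Num.max C 1 by rewrite lt_max ltr01 orbT.
apply: (mean_integrable_le _ _ _ mphi _ (iS _ C0)) => w; apply: (le_trans (hC w)).
by rewrite ler_expR ler_wpM2r ?addr_ge0// le_max lexx.
Qed.

End Subexponential.
Arguments linear_growth {R d W} S phi.
Arguments exp_growth {R d W} S phi.

(** * Exponential tilting at one starting point *)

(** Z and I stand for omega(X_delta) and the integral of omega along the path;
    zeta l and iota l bound their entropic utilities of order l.  The exponent Y
    of the tilt is within c + k I + M Z of a constant kappa, which cancels in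
    every homogeneous estimate. *)
Section OnePointTilt.
Context {R : realType} {d : measure_display} {W : measurableType d}.
Variables (P : probability W R) (Z I : W -> R) (zeta iota : R -> R).
Local Notation "'E phi" := (Rintegral P setT phi) (at level 10, phi at level 8).
Local Notation intg phi := (P.-integrable setT (EFin \o phi)).
Hypotheses (Z0 : forall w, 0 <= Z w) (I0 : forall w, 0 <= I w).
Hypotheses (mZ : measurable_fun setT Z) (mI : measurable_fun setT I).
Hypothesis hZ : forall l, 0 < l -> (entropic P l Z <= (zeta l)%:E)%E.
Hypothesis hI : forall l, 0 < l -> (entropic P l I <= (iota l)%:E)%E.

Let S w := Z w + I w.
Let S0 w : 0 <= S w. Proof. exact: addr_ge0. Qed.

Let expE (k a : R) (phi : W -> R) : 0 <= k -> measurable_fun setT phi ->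
  (0 < k -> (entropic P (2 * k) phi <= a%:E)%E) ->
  intg (fun w => expR (2 * (k * phi w))) /\
  'E (fun w => expR (2 * (k * phi w))) <= expR (2 * (k * a)).
Proof.
rewrite le_eqVlt => /predU1P[<- mp _|k0 mp /(_ k0) h].
  under eq_fun do rewrite mul0r mulr0 expR0.
  rewrite mul0r mulr0 expR0 mean_cst lexx; split => //.
  by apply: finite_measure_integrable_cst.
have k2 : 0 < 2 * k by lra.
have [h1 h2] := entropic_exp_moment P _ _ _ k2 mp h.
by rewrite mulrA; under eq_fun do rewrite mulrA.
Qed.

(** The orders 2 k and 2 M come from Cauchy-Schwarz: no independence of I and Z
    is available. *)
Lemma exp_moment_joint (k M c : R) : 0 <= k -> 0 <= M ->
  intg (fun w => expR (c + k * I w + M * Z w)) /\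
  'E (fun w => expR (c + k * I w + M * Z w)) <=
    expR (c + k * iota (2 * k) + M * zeta (2 * M)).
Proof.
move=> k0 M0.
have [i1 e1] := expE k (iota (2 * k)) I k0 mI (fun k0 => hI _ (mulr_gt0 (ltr0n _ 2) k0)).
have [i2 e2] := expE M (zeta (2 * M)) Z M0 mZ (fun k0 => hZ _ (mulr_gt0 (ltr0n _ 2) k0)).
have [i3 e3] := exp_moment_add P _ _ _ _ (measurable_funM (measurable_cst k) mI)
  (measurable_funM (measurable_cst M) mZ) i1 i2 e1 e2.
have E w : expR (c + k * I w + M * Z w) = expR c * expR (k * I w + M * Z w).
  by rewrite -expRD addrA.
under eq_fun do rewrite E; split; first exact: mean_integrableZ.
by rewrite meanZ// -!addrA expRD ler_pM2l ?expR_gt0.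
Qed.

Let iS C : 0 < C -> intg (fun w => expR (C * (1 + S w))).
Proof.
move=> C0; have [+ _] := exp_moment_joint C C C (ltW C0) (ltW C0).
by congr (integrable _ _ _); apply/funext => w /=; rewrite /S; congr (expR _)%:E; ring.
Qed.

Lemma linear_growth_size : linear_growth S Z /\ linear_growth S I.
Proof.
by split; split => //; exists 1 => w; rewrite mul1r ger0_norm// /S;
  have := Z0 w; have := I0 w; lra.
Qed.

Let exp_growth_intg phi : exp_growth S phi -> intg phi.
Proof. exact: (exp_growth_integrable S0 iS). Qed.

Lemma mean_le_entropic (phi : W -> R) (a : R) : linear_growth S phi ->
  (entropic P 1 phi <= a%:E)%E -> 'E phi <= a.
Proof.
move=> lp h; have [ie] := entropic_exp_moment P 1 a phi ltr01 lp.1 h.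
rewrite mul1r => Ee.
have e1 (f : W -> R) : (fun w => (fun=> 1) w * f w) = f.
  by apply/funext => w; rewrite mul1r.
have := weighted_jensen_le P (fun=> 1) phi a; rewrite !e1 mean_cst !mulr1; apply => //.
- by apply: exp_growth_intg; apply: linear_exp_growth => //; exact: linear_growth_cst.
- by apply: exp_growth_intg; exact: linear_exp_growth.
- by apply: exp_growth_intg; exact: exp_growth_expR.
- by move: Ee; under eq_fun do rewrite mul1r.
Qed.

Section Tilt.
Variables (k M c kappa : R) (Y : W -> R).
Hypotheses (k0 : 0 <= k) (M0 : 0 <= M) (c0 : 0 <= c).
Hypothesis mY : measurable_fun setT Y.
Hypothesis hY : forall w, `|Y w - kappa| <= c + k * I w + M * Z w.

Let D w := c + k * I w + M * Z w.
Let m := c + k * iota 1 + M * zeta 1.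

Let lg_D : linear_growth S D.
Proof.
have [lZ lI] := linear_growth_size.
apply: linear_growthD; last exact: linear_growthZ.
by apply: linear_growthD; [exact: linear_growth_cst|exact: linear_growthZ].
Qed.

Lemma tilt_linear_growth : linear_growth S Y.
Proof.
split => //; have [_ [C hC]] := linear_growthD lg_D (linear_growth_cst S0 `|kappa|).
exists C => w; apply: le_trans (le_trans (ler_norm _) (hC w)).
have := ler_normD (Y w - kappa) kappa; rewrite subrK; have := hY w; rewrite /D; lra.
Qed.

Lemma tilt_integrable : intg (fun w => expR (Y w)).
Proof.
by apply: exp_growth_intg; apply: exp_growth_expR; exact: tilt_linear_growth.
Qed.

Let E_D : 'E D <= m.
Proof.
have [lZ lI] := linear_growth_size.
have iZ : intg Z by apply: exp_growth_intg; exact: linear_exp_growth.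
have iI : intg I by apply: exp_growth_intg; exact: linear_exp_growth.
have i1 : intg (fun=> c) by apply: finite_measure_integrable_cst.
rewrite /D meanD; [|by apply: mean_integrableD => //; exact: mean_integrableZ|exact: mean_integrableZ].
rewrite meanD//; last exact: mean_integrableZ.
rewrite !meanZ// mean_cst /m.
have h1 : 'E I <= iota 1 by apply: mean_le_entropic => //; exact: hI.
have h2 : 'E Z <= zeta 1 by apply: mean_le_entropic => //; exact: hZ.
have := ler_wpM2l k0 h1; have := ler_wpM2l M0 h2; lra.
Qed.

Let D0 w : 0 <= D w.
Proof. by rewrite /D !addr_ge0// mulr_ge0. Qed.

(** Jensen's inequality with weight the indicator of A: on an event of
    probability at least p the mean of c + k I + M Z, conditionally on A, is at
    most its total mean divided by p. *)
Lemma tilt_mass_ge (A : set W) (p : R) : measurable A -> 0 < p ->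
  p <= 'E \1_A ->
  p * expR (kappa - m / p) <= 'E (fun w => \1_A w * expR (Y w)).
Proof.
move=> mA p0 pA.
have egA := @exp_growth_indic R _ W S A mA.
have lY := tilt_linear_growth.
have egY := linear_exp_growth lY.
have iAY : intg (fun w => \1_A w * Y w) by apply: exp_growth_intg; exact: exp_growthM.
have iA : intg \1_A by exact: exp_growth_intg.
have iD : intg D by apply: exp_growth_intg; exact: linear_exp_growth.
have A01 w : 0 <= (\1_A w : R) <= 1.
  by rewrite indicE; case: (w \in A); rewrite ?lexx ?ler01.
have H : (kappa - m / p) * 'E \1_A <= 'E (fun w => \1_A w * Y w).
  apply: (@le_trans _ _ ('E (fun w => kappa * \1_A w + (- 1) * D w))).
    rewrite meanD; try exact: mean_integrableZ.
    rewrite !meanZ//.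
    have m0 : 0 <= m by apply: le_trans E_D; apply: Rintegral_ge0 => w _; exact: D0.
    have : m <= m / p * 'E \1_A by rewrite mulrAC ler_pdivlMr// ler_wpM2l.
    by have := E_D; lra.
  apply: mean_mono => //; first by apply: mean_integrableD; exact: mean_integrableZ.
  move=> w; have /andP[a0 a1] := A01 w; have := hY w; rewrite -/(D w) ler_norml => /andP[h1 h2].
  have := ler_wpM2l a0 h1; have := ler_wpM2r (D0 w) a1; lra.
apply: le_trans (weighted_jensen_ge P \1_A Y _ _ _ _ _ H) => //.
- by rewrite mulrC ler_pM2l ?expR_gt0.
- by apply: exp_growth_intg; apply: exp_growthM => //; exact: exp_growth_expR.
Qed.

Lemma tilt_norm_ge : expR (kappa - m) <= 'E (fun w => expR (Y w)).
Proof.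
have := tilt_mass_ge setT 1 measurableT ltr01.
rewrite indicT mean_cst divr1 mul1r => /(_ (lexx _)).
by under eq_fun do rewrite mul1r.
Qed.

Lemma tilt_moment_le (lam : R) : 0 <= lam ->
  'E (fun w => expR (Y w) * expR (lam * Z w)) <=
    expR (kappa + (c + k * iota (2 * k) + (M + lam) * zeta (2 * (M + lam)))).
Proof.
move=> lam0; have Mlam : 0 <= M + lam by exact: addr_ge0.
have [i1 e1] := exp_moment_joint k (M + lam) c k0 Mlam.
have [lZ lI] := linear_growth_size.
rewrite expRD; apply: le_trans (ler_wpM2l (expR_ge0 kappa) e1).
rewrite -meanZ//; apply: mean_mono.
- apply: exp_growth_intg; apply: exp_growthM; apply: exp_growth_expR => //.
    exact: tilt_linear_growth.
  exact: linear_growthZ.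
- exact: mean_integrableZ.
- move=> w; rewrite -!expRD ler_expR; have := le_trans (ler_norm _) (hY w).
  by lra.
Qed.

Lemma tilt_norm_le :
  'E (fun w => expR (Y w)) <= expR (kappa + (c + k * iota (2 * k) + M * zeta (2 * M))).
Proof.
have := tilt_moment_le 0 (lexx _); rewrite addr0.
by under eq_fun do rewrite mul0r expR0 mulr1.
Qed.

(** Jensen's inequality for the weight exp Y and the function lam * Z.  Both the
    upper bound on E[exp(Y + lam Z)] and the lower bound on E[exp Y] carry the
    factor exp kappa.  In the slope, lam multiplies only zeta, so that dividing
    by a large lam leaves the contraction rate of the untilted process. *)
Lemma tilt_drift (lam : R) : 0 < lam ->
  lam * 'E (fun w => expR (Y w) * Z w) <=
  (c + k * iota (2 * k) + (M + lam) * zeta (2 * (M + lam)) + m) *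
    'E (fun w => expR (Y w)).
Proof.
move=> lam0; have [lZ lI] := linear_growth_size.
have lY := tilt_linear_growth.
have eY := exp_growth_expR lY.
have eZ := linear_exp_growth lZ.
have lamZ : linear_growth S (fun w => lam * Z w) by exact: linear_growthZ.
rewrite -meanZ; last by apply: exp_growth_intg; exact: exp_growthM.
under eq_fun do rewrite mulrCA.
apply: weighted_jensen_le.
- by move=> w; exact: expR_ge0.
- exact: exp_growth_intg.
- apply: exp_growth_intg; apply: exp_growthM => //; exact: linear_exp_growth.
- apply: exp_growth_intg; apply: exp_growthM => //; exact: exp_growth_expR.
apply: (le_trans (tilt_moment_le lam (ltW lam0))).
set u := c + _ + _.
apply: le_trans (ler_wpM2l (expR_ge0 (u + m)) tilt_norm_ge).
by rewrite -expRD ler_expR; lra.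
Qed.

(** The weaker substitute for a minorization of the tilted law by a measure:
    the lower bound depends on A only through p. *)
Lemma tilt_minorization (A : set W) (p : R) : measurable A -> 0 < p ->
  p <= 'E \1_A ->
  p * expR (- (m / p + (c + k * iota (2 * k) + M * zeta (2 * M)))) *
    'E (fun w => expR (Y w)) <= 'E (fun w => \1_A w * expR (Y w)).
Proof.
move=> mA p0 pA; apply: le_trans (tilt_mass_ge A p mA p0 pA).
rewrite -mulrA ler_pM2l//.
apply: (le_trans (ler_wpM2l (expR_ge0 _) tilt_norm_le)).
by rewrite -expRD ler_expR; lra.
Qed.

(** The Gibbs variational bound: exp Y2 = exp Y * exp (Y2 - Y), and Jensen's
    inequality for the weight exp Y bounds ln E[exp Y] - ln E[exp Y2] by the
    tilted mean of Y - Y2.  The event A, on which H contributes at most the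
    weight term, carries the gain eps; with A empty and eps = 0 nothing is
    gained. *)
Lemma tilt_compare (Y2 H : W -> R) (A : set W) (eps z kap s beta : R) :
  linear_growth S Y2 -> measurable A -> 0 <= s -> 0 <= beta ->
  (forall w, Y w - Y2 w = kap + H w) ->
  (forall w, H w <= s * (1 - \1_A w + beta * Z w)) ->
  eps * 'E (fun w => expR (Y w)) <= 'E (fun w => \1_A w * expR (Y w)) ->
  'E (fun w => expR (Y w) * Z w) <= z * 'E (fun w => expR (Y w)) ->
  ln ('E (fun w => expR (Y w))) - ln ('E (fun w => expR (Y2 w))) <=
    kap + s * (1 - eps + beta * z).
Proof.
move=> lY2 mA s0 b0 YY2 Hle epsA Zz.
have [lZ lI] := linear_growth_size.
have lY := tilt_linear_growth.
have lYY2 : linear_growth S (fun w => Y2 w + (- 1) * Y w).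
  by apply: linear_growthD => //; exact: linear_growthZ.
have eY := exp_growth_expR lY.
have eZ := linear_exp_growth lZ.
have iY := exp_growth_intg _ eY.
have iYZ : intg (fun w => expR (Y w) * Z w).
  by apply: exp_growth_intg; exact: exp_growthM.
have iAY : intg (fun w => \1_A w * expR (Y w)).
  by apply: exp_growth_intg; apply: exp_growthM => //; exact: exp_growth_indic.
set N := 'E (fun w => expR (Y w)) in epsA Zz *.
have N0 : 0 < N by apply: lt_le_trans tilt_norm_ge; exact: expR_gt0.
have J : expR (- (kap + s * (1 - eps + beta * z))) * N <=
    'E (fun w => expR (Y w) * expR (Y2 w + (- 1) * Y w)).
  apply: weighted_jensen_ge => //.
  - by apply: exp_growth_intg; apply: exp_growthM => //; exact: linear_exp_growth.
  - by apply: exp_growth_intg; apply: exp_growthM => //; exact: exp_growth_expR.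
  have ib : intg (fun w => (- (kap + s)) * expR (Y w)
      + (s * (\1_A w * expR (Y w)) + (- (s * beta)) * (expR (Y w) * Z w))).
    by apply: mean_integrableD; [exact: mean_integrableZ|apply: mean_integrableD; exact: mean_integrableZ].
  apply: (@le_trans _ _ ('E (fun w => (- (kap + s)) * expR (Y w)
      + (s * (\1_A w * expR (Y w)) + (- (s * beta)) * (expR (Y w) * Z w))))).
    rewrite meanD; [|exact: mean_integrableZ|by apply: mean_integrableD; exact: mean_integrableZ].
    rewrite meanD; try exact: mean_integrableZ.
    rewrite !meanZ// -/N.
    have := ler_wpM2l s0 epsA; have := ler_wpM2l (mulr_ge0 s0 b0) Zz.
    by lra.
  apply: mean_mono => //.
    by apply: exp_growth_intg; apply: exp_growthM => //; exact: linear_exp_growth.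
  move=> w; have := Hle w; have := YY2 w => e1 e2.
  have e3 : - (kap + s * (1 - \1_A w + beta * Z w)) <= Y2 w + (- 1) * Y w by lra.
  have := ler_wpM2l (expR_ge0 (Y w)) e3; lra.
rewrite (_ : (fun w => expR (Y w) * expR (Y2 w + (- 1) * Y w)) =
    (fun w => expR (Y2 w))) in J; last first.
  by apply/funext => w; rewrite -expRD; congr expR; ring.
have J0 := lt_le_trans (mulr_gt0 (expR_gt0 _) N0) J.
move: J; rewrite -ler_ln ?posrE ?mulr_gt0 ?expR_gt0//.
rewrite lnM ?posrE ?expR_gt0// expRK; lra.
Qed.

End Tilt.
End OnePointTilt.

(** * Weighted spans and the operator as a least upper bound *)

Lemma separating_constant (R : realType) (T : pointedType) (p q : T -> R) :
  (forall x y, p x <= q y) -> exists kappa, forall x, p x <= kappa <= q x.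
Proof.
move=> pq; exists (sup (range p)) => x.
have hs : has_sup (range p).
  split; first by exists (p point); exists point.
  by exists (q point) => _ [y _ <-].
apply/andP; split; first by apply: ub_le_sup; [case: hs|exists x].
by apply: sup_le_ub => [|_ [y _ <-]//]; case: hs.
Qed.

Section Spans.
Context {R : realType} {n : nat}.
Variable omega : 'rV[R]_n -> R.
Hypothesis omega_ge0 : forall x, 0 <= omega x.
Implicit Types g : 'rV[R]_n -> R.

Lemma weight2_gt0 (beta : R) x y : 0 <= beta ->
  0 < 2 + beta * omega x + beta * omega y.
Proof.
move=> b0; have := mulr_ge0 b0 (omega_ge0 x); have := mulr_ge0 b0 (omega_ge0 y); lra.
Qed.

Lemma wspan_leP (beta s : R) g : 0 <= beta ->
  (wspan omega beta (EFin \o g) <= s%:E)%E <->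
  forall x y, g x - g y <= s * (2 + beta * omega x + beta * omega y).
Proof.
move=> b0; split => [H x y|H].
  have : ((((g x)%:E - (g y)%:E)
      * ((2 + beta * omega x + beta * omega y)^-1)%:E)%E <= s%:E)%E.
    by apply: le_trans H; apply: ereal_sup_ubound; exists (x, y).
  by rewrite -EFinB -EFinM lee_fin ler_pdivrMr// weight2_gt0.
apply: ge_ereal_sup => _ [[x y] _ <-] /=.
by rewrite -EFinB -EFinM lee_fin ler_pdivrMr ?weight2_gt0.
Qed.

Lemma wspan_ge0 (beta : R) g : (0 <= wspan omega beta (EFin \o g))%E.
Proof.
by apply: ereal_sup_ubound; exists (0, 0) => //=; rewrite -EFinB subrr mul0e.
Qed.

(** A span is a weighted supremum norm modulo constants. *)
Lemma wspan_center (beta s : R) g : 0 <= beta ->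
  (wspan omega beta (EFin \o g) <= s%:E)%E ->
  exists kappa, forall x, `|g x - kappa| <= s * (1 + beta * omega x).
Proof.
move=> b0 /(wspan_leP _ _ _ b0) H.
have [kappa hk] := @separating_constant R 'rV[R]_n
  (fun x => g x - s * (1 + beta * omega x))
  (fun x => g x + s * (1 + beta * omega x)) (fun x y => ltac:(have := H x y; lra)).
by exists kappa => x; have /andP[h1 h2] := hk x; rewrite ler_norml; apply/andP; split; lra.
Qed.

Lemma Cw_bound g : Cw omega g ->
  exists2 C, 0 < C & forall x, `|g x| <= C * (1 + omega x).
Proof.
move=> [_]; rewrite /wnorm; set E := [set _ | _ in _] => Eoo.
have w0 x : 0 < 1 + omega x by have := omega_ge0 x; lra.
have ub x : ((`|g x| / (1 + omega x))%:E <= ereal_sup E)%E.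
  by apply: ereal_sup_ubound; exists x.
case: (ereal_sup E) Eoo ub => [r|//|] _ ub.
  exists (Num.max r 1); first by rewrite lt_max ltr01 orbT.
  move=> x; rewrite -ler_pdivrMr// le_max; apply/orP; left.
  by rewrite -lee_fin ub.
by exists 1 => // x; have := ub x; rewrite leeNy_eq.
Qed.

End Spans.

Section ROp.
Context {R : realType} {n : nat} {dW : measure_display} {W : measurableType dW}.
Variables (X : R -> W -> 'rV[R]_n) (P : 'rV[R]_n -> probability W R).
Variables (U : set 'rV[R]_n) (delta : R) (f : 'rV[R]_n -> R).
Variables (c : 'rV[R]_n -> 'rV[R]_n -> R) (gamma : R).

(** Bounds on v and c keep the supremum finite; this also covers an empty U,
    whose supremum is -oo. *)
Lemma R_op_lub (g v : 'rV[R]_n -> R) (B : R) x :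
  (forall y, entropic (P y) gamma
      (fun w => path_integral X delta f w + g (X delta w)) = (v y)%:E) ->
  (forall xi, U xi -> v xi <= B) ->
  (forall xi, U xi -> c x xi <= 0) ->
  exists rho, [/\ R_op X P U delta f c gamma g x = rho%:E,
    v x <= rho, (forall xi, U xi -> v xi + c x xi <= rho) &
    forall b, v x <= b -> (forall xi, U xi -> v xi + c x xi <= b) -> rho <= b].
Proof.
move=> hv hB hc; rewrite /R_op hv.
set E := [set _ | _ in _].
have EE : E = [set (v xi + c x xi)%:E | xi in U].
  by apply/seteqP; split=> _ [xi Uxi <-]; exists xi => //; rewrite hv.
have Eub : (ereal_sup E <= B%:E)%E.
  rewrite EE; apply: ge_ereal_sup => _ [xi Uxi <-]; rewrite lee_fin.
  by have := hB _ Uxi; have := hc _ Uxi; lra.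
have mfin : maxe (v x)%:E (ereal_sup E) \is a fin_num.
  rewrite fin_numE; apply/andP; split.
    by rewrite -ltNye lt_max ltNyr.
  by rewrite -ltey gt_max ltry (le_lt_trans Eub)// ltry.
exists (fine (maxe (v x)%:E (ereal_sup E))); split.
- by rewrite fineK.
- by rewrite -lee_fin fineK// le_max lexx.
- move=> xi Uxi; rewrite -lee_fin fineK// le_max; apply/orP; right.
  by apply: ereal_sup_ubound; rewrite EE; exists xi.
- move=> b vb cb; rewrite -lee_fin fineK// ge_max lee_fin vb/= EE.
  by apply: ge_ereal_sup => _ [xi Uxi <-]; rewrite lee_fin cb.
Qed.

End ROp.

(** * Tilted one-step estimates for the process *)

(** The quantity V_g(a) above, with the exponent in the form in
    which it occurs inside the entropic utility of order gamma. *)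
Definition log_mgf {R : realType} {n : nat} {dW : measure_display}
    {W : measurableType dW} (X : R -> W -> 'rV[R]_n)
    (P : 'rV[R]_n -> probability W R) (delta : R) (f : 'rV[R]_n -> R)
    (gamma : R) (g : 'rV[R]_n -> R) (a : 'rV[R]_n) : R :=
  ln (\int[P a]_w
    expR (gamma * (path_integral X delta f w + g (X delta w) / gamma))).

Section OnePointEstimates.
Context {R : realType} {n : nat} {dW : measure_display} {W : measurableType dW}.
Context {F : R -> set (set W)} {X : R -> W -> 'rV[R]_n}.
Context {P : 'rV[R]_n -> probability W R}.
Variables (delta : R) (omega f : 'rV[R]_n -> R) (gamma C b1 M : R) (M1 M2 : R -> R).
Hypothesis hX : feller_markov F X P.
Hypothesis delta0 : 0 < delta.
Hypothesis omega_cont : continuous omega.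
Hypothesis omega0 : forall x, 0 <= omega x.
Hypothesis f_cont : continuous f.
Hypothesis C0 : 0 < C.
Hypothesis f_le : forall x, `|f x| <= C * (1 + omega x).
Hypothesis gamma0 : gamma < 0.
Hypothesis b1P : 0 < b1 < 1.
Hypothesis M0 : 0 <= M.
Hypothesis momentI : forall l x,
  (entropic (P x) l (path_integral X delta omega) <= (omega x + M1 l)%:E)%E.
Hypothesis momentZ : forall l x,
  (entropic (P x) l (fun w => omega (X delta w)) <= (b1 * omega x + M2 l)%:E)%E.

Let I := path_integral X delta omega.
Let Z w := omega (X delta w).
Let zeta a l := b1 * omega a + M2 l.
Let iota a l := omega a + M1 l.
Let k := - gamma * C.
Let c := k * delta + M.
Let Y g w := gamma * (path_integral X delta f w + g (X delta w) / gamma).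

Let k0 : 0 < k. Proof. by rewrite /k mulr_gt0// oppr_gt0. Qed.
Let c0 : 0 <= c. Proof. by rewrite /c addr_ge0// mulr_ge0 ?ltW. Qed.
Let Z0 w : 0 <= Z w. Proof. exact: omega0. Qed.
Let I0 w : 0 <= I w. Proof. exact: path_integral_ge0. Qed.
Let mZ : measurable_fun setT Z.
Proof. by apply: (measurable_process hX) => //; exact: ltW. Qed.
Let mI : measurable_fun setT I.
Proof. exact: (measurable_path_integral hX). Qed.
Let hZ a l : 0 < l -> (entropic (P a) l Z <= (zeta a l)%:E)%E.
Proof. by move=> _; exact: momentZ. Qed.
Let hI a l : 0 < l -> (entropic (P a) l I <= (iota a l)%:E)%E.
Proof. by move=> _; exact: momentI. Qed.

Let adm (g : 'rV[R]_n -> R) kappa :=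
  continuous g /\ forall x, `|g x - kappa| <= M * (1 + omega x).

Let Y_measurable g : continuous g -> measurable_fun setT (Y g).
Proof.
move=> cg; apply: measurable_funM => //; apply: measurable_funD.
  exact: (measurable_path_integral hX).
by apply: measurable_funM => //; apply: (measurable_process hX) => //; exact: ltW.
Qed.

Let Y_bound g kappa w : adm g kappa ->
  `|Y g w - kappa| <= c + k * I w + M * Z w.
Proof.
move=> [_ hg].
have -> : Y g w - kappa = gamma * path_integral X delta f w + (g (X delta w) - kappa).
  by rewrite /Y; field; rewrite lt_eqF.
apply: (le_trans (ler_normD _ _)).
have h1 := hg (X delta w).
have := path_integral_le_weight hX delta C omega f w (ltW delta0) (ltW C0)
  omega_cont f_cont f_le.
rewrite normrM (ltr0_norm gamma0) -/(I w) => h2.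
have g0 : 0 <= - gamma by rewrite oppr_ge0 ltW.
have := ler_wpM2l g0 h2; rewrite /c /k /Z; lra.
Qed.

Let N g a := \int[P a]_w expR (Y g w).

Let N_gt0 g kappa a : adm g kappa ->
  expR (kappa - (c + k * iota a 1 + M * zeta a 1)) <= N g a.
Proof.
move=> hg; apply: (tilt_norm_ge (P a) Z I (zeta a) (iota a)) => //.
- exact: ltW.
- by apply: Y_measurable; case: hg.
- by move=> w; exact: Y_bound.
Qed.

Lemma entropic_log_mgf (g : 'rV[R]_n -> R) (kappa : R) (a : 'rV[R]_n) : continuous g ->
  (forall x, `|g x - kappa| <= M * (1 + omega x)) ->
  entropic (P a) gamma (fun w => path_integral X delta f w + g (X delta w) / gamma)
  = (log_mgf X P delta f gamma g a / gamma)%:E.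
Proof.
move=> cg hg; have ag : adm g kappa by [].
have iY : (P a).-integrable setT (EFin \o (fun w => expR (Y g w))).
  apply: (tilt_integrable (P a) Z I (zeta a) (iota a) _ _ _ _ _ _ k M c kappa) => //.
  - exact: Y_measurable.
  - by move=> w; exact: Y_bound.
have Npos : 0 < N g a by apply: lt_le_trans (N_gt0 g kappa a ag); exact: expR_gt0.
rewrite /entropic lt_eqF// unlock.
rewrite -[X in lne X]fineK; last exact: integrable_fin_num.
by rewrite -/(Rintegral _ _ _) lne_EFin// -EFinM mulrC.
Qed.

Lemma log_mgf_ge (g : 'rV[R]_n -> R) (kappa : R) (a : 'rV[R]_n) : continuous g ->
  (forall x, `|g x - kappa| <= M * (1 + omega x)) ->
  kappa - (c + k * iota a 1 + M * zeta a 1) <= log_mgf X P delta f gamma g a.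
Proof.
move=> cg hg; have := N_gt0 g kappa a (conj cg hg).
rewrite -ler_ln ?posrE ?expR_gt0// ?expRK//.
by apply: lt_le_trans (N_gt0 g kappa a (conj cg hg)); exact: expR_gt0.
Qed.

(* The slope of the drift bound is b1 + (2 k + M b1 + M) / lam; this lam brings
   it below b = (1 + b1) / 2. *)
Let lam := 4 * (k + M) / (1 - b1).
Let cdrift := c + k * M1 (2 * k) + (M + lam) * M2 (2 * (M + lam))
  + (c + k * M1 1 + M * M2 1).
Let b := (1 + b1) / 2.
Let K := `|cdrift| / lam.

Let lam_gt0 : 0 < lam.
Proof.
have /andP[_ b11] := b1P; rewrite /lam divr_gt0//; last by rewrite subr_gt0.
by rewrite mulr_gt0// ltr_wpDr.
Qed.

Let drift g kappa a : adm g kappa ->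
  \int[P a]_w (expR (Y g w) * Z w) <= (b * omega a + K) * N g a.
Proof.
move=> hg.
have Npos : 0 < N g a by apply: lt_le_trans (N_gt0 g kappa a hg); exact: expR_gt0.
have H : lam * \int[P a]_w (expR (Y g w) * Z w) <=
    (c + k * iota a (2 * k) + (M + lam) * zeta a (2 * (M + lam))
      + (c + k * iota a 1 + M * zeta a 1)) * N g a.
  apply: (tilt_drift (P a) Z I (zeta a) (iota a) _ _ _ _ _ _ k M c kappa) => //.
  - exact: ltW.
  - by apply: Y_measurable; case: hg.
  - by move=> w; exact: Y_bound.
rewrite -(ler_pM2l lam_gt0); apply: (le_trans H).
rewrite [leRHS]mulrA ler_pM2r//.
have /andP[b10 b11] := b1P.
have lamE : lam * (1 - b1) = 4 * (k + M).
  by rewrite /lam; field; rewrite subr_eq0 gt_eqF.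
have KE : lam * K = `|cdrift|.
  by rewrite /K; field; rewrite gt_eqF.
apply: (@le_trans _ _ (lam * (b * omega a) + cdrift)); last first.
  by rewrite [leRHS]mulrDr KE lerD2l ler_norm.
rewrite /cdrift /iota /zeta.
have lb : lam * b = lam * b1 + 2 * (k + M) by rewrite /b; lra.
have h : 0 <= (M * (1 - b1)) * omega a by rewrite !mulr_ge0// subr_ge0 ltW.
have -> : lam * (b * omega a) = (lam * b1 + 2 * (k + M)) * omega a.
  by rewrite mulrA lb.
lra.
Qed.

(* Upper bounds, for omega a <= r, on the two exponents of tilt_minorization. *)
Let mR r := c + k * (r + M1 1) + M * (b1 * r + M2 1).
Let uR r := c + k * (r + M1 (2 * k)) + M * (b1 * r + M2 (2 * M)).

Let gain g kappa a (A : set W) (r p : R) : adm g kappa -> measurable A -> 0 < p ->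
  omega a <= r -> p <= \int[P a]_w \1_A w ->
  p * expR (- (mR r / p + uR r)) * N g a <= \int[P a]_w (\1_A w * expR (Y g w)).
Proof.
move=> hg mA p0 ar pA.
have Npos : 0 < N g a by apply: lt_le_trans (N_gt0 g kappa a hg); exact: expR_gt0.
have H : p * expR (- ((c + k * iota a 1 + M * zeta a 1) / p +
    (c + k * iota a (2 * k) + M * zeta a (2 * M)))) * N g a <=
    \int[P a]_w (\1_A w * expR (Y g w)).
  apply: (tilt_minorization (P a) Z I (zeta a) (iota a) _ _ _ _ _ _ k M c kappa) => //.
  - exact: ltW.
  - by apply: Y_measurable; case: hg.
  - by move=> w; exact: Y_bound.
apply: le_trans H; rewrite ler_pM2r// ler_pM2l// ler_expR lerN2.
have /andP[b10 b11] := b1P.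
have h1 := ler_wpM2l (ltW k0) ar.
have h2 := ler_wpM2l M0 (ler_wpM2l (ltW b10) ar).
apply: lerD; last by rewrite /uR /iota /zeta; lra.
by rewrite ler_pM2r ?invr_gt0// /mR /iota /zeta; lra.
Qed.

Lemma log_mgf_compare (g1 g2 : 'rV[R]_n -> R) (kappa1 kappa2 kap s beta : R)
    (a : 'rV[R]_n) :
  continuous g1 -> (forall x, `|g1 x - kappa1| <= M * (1 + omega x)) ->
  continuous g2 -> (forall x, `|g2 x - kappa2| <= M * (1 + omega x)) ->
  0 <= s -> 0 <= beta ->
  (forall x, g1 x - g2 x - kap <= s * (1 + beta * omega x)) ->
  log_mgf X P delta f gamma g1 a - log_mgf X P delta f gamma g2 a
    <= kap + s * (1 + beta * (b * omega a + K)) /\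
  forall r p : R, 0 < p -> omega a <= r ->
    (p%:E <= P a (X delta @^-1` [set x | (g1 x - g2 x <= kap)%R]))%E ->
    log_mgf X P delta f gamma g1 a - log_mgf X P delta f gamma g2 a
    <= kap + s * (1 - p * expR (- (mR r / p + uR r))
                   + beta * (b * omega a + K)).
Proof.
move=> cg1 hg1 cg2 hg2 s0 beta0 hH.
have a1 : adm g1 kappa1 by [].
have a2 : adm g2 kappa2 by [].
have lY2 : linear_growth (fun w => Z w + I w) (Y g2).
  apply: (tilt_linear_growth Z I _ _ _ _ k M c kappa2) => //.
    exact: Y_measurable.
  by move=> w; exact: Y_bound.
have YY w : Y g1 w - Y g2 w = kap + (g1 (X delta w) - g2 (X delta w) - kap).
  by rewrite /Y; field; rewrite lt_eqF.
have cmp A eps : measurable A ->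
    (forall w, g1 (X delta w) - g2 (X delta w) - kap
       <= s * (1 - \1_A w + beta * Z w)) ->
    eps * N g1 a <= \int[P a]_w (\1_A w * expR (Y g1 w)) ->
    log_mgf X P delta f gamma g1 a - log_mgf X P delta f gamma g2 a
    <= kap + s * (1 - eps + beta * (b * omega a + K)).
  move=> mA hA he.
  apply: (tilt_compare (P a) Z I (zeta a) (iota a) _ _ _ _ _ _ k M c kappa1 (Y g1)
    _ _ _ _ _ (Y g2) (fun w => g1 (X delta w) - g2 (X delta w) - kap) A) => //.
  - exact: ltW.
  - exact: Y_measurable.
  - by move=> w; exact: Y_bound.
  - exact: (drift g1 kappa1).
split.
  rewrite -[X in s * (X + _)]subr0; apply: (cmp set0) => //.
    by move=> w; rewrite indicE in_set0 subr0; exact: hH.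
  rewrite mul0r; apply: Rintegral_ge0 => w _.
  by rewrite mulr_ge0 ?expR_ge0// indicE.
move=> r p p0 ar pA.
set B := [set x | g1 x - g2 x <= kap].
have mA : measurable (X delta @^-1` B).
  apply: (measurable_preimage_process hX delta (B : set (borelRn R n))); first exact: ltW.
  exact: measurable_sublevel.
apply: (cmp (X delta @^-1` B)) => //.
  move=> w; rewrite indicE; case: (boolP (w \in _)) => [/set_mem|_] /=.
    rewrite /B /= => hw; rewrite subrr add0r.
    by apply: (@le_trans _ _ 0); [lra|rewrite !mulr_ge0].
  by rewrite subr0; exact: hH.
apply: (gain g1 kappa1) => //.
by rewrite -lee_fin /Rintegral integral_indic// setIT fineK ?fin_num_measure.
Qed.

(** The form in which the estimates are used: K and eps are chosen before the
    functions g1 and g2, and depend on them only through M.  Exchanging g1 and g2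
    turns the upper bound into a lower bound. *)
Lemma one_point_estimates : exists (K : R) (eps : R -> R -> R),
  [/\ 0 <= K, (forall r p, 0 < p -> 0 < eps r p) &
   forall (g1 g2 : 'rV[R]_n -> R) (kappa1 kappa2 kap s beta : R)
     (a : 'rV[R]_n),
   continuous g1 -> (forall x, `|g1 x - kappa1| <= M * (1 + omega x)) ->
   continuous g2 -> (forall x, `|g2 x - kappa2| <= M * (1 + omega x)) ->
   0 <= s -> 0 <= beta ->
   (forall x, g1 x - g2 x - kap <= s * (1 + beta * omega x)) ->
   let dV := log_mgf X P delta f gamma g1 a - log_mgf X P delta f gamma g2 a in
   dV <= kap + s * (1 + beta * ((1 + b1) / 2 * omega a + K)) /\
   forall r p : R, 0 < p -> omega a <= r ->
     (p%:E <= P a (X delta @^-1` [set x | (g1 x - g2 x <= kap)%R]))%E ->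
     dV <= kap + s * (1 - eps r p + beta * ((1 + b1) / 2 * omega a + K))].
Proof.
exists K, (fun r p => p * expR (- (mR r / p + uR r))); split.
- by rewrite /K divr_ge0// ltW.
- by move=> r p p0; rewrite mulr_gt0// expR_gt0.
- by move=> *; exact: log_mgf_compare.
Qed.

(** Since gamma < 0, this bounds the shift option of the operator from above. *)
Lemma log_mgf_lower_bound (g : 'rV[R]_n -> R) (kappa r : R) : continuous g ->
  (forall x, `|g x - kappa| <= M * (1 + omega x)) ->
  exists q, forall a, omega a <= r -> q <= log_mgf X P delta f gamma g a.
Proof.
move=> cg hg; exists (kappa - mR r) => a ar.
apply: le_trans (log_mgf_ge g kappa a cg hg); rewrite lerD2l lerN2 /mR.
have /andP[b10 b11] := b1P.
have := ler_wpM2l (ltW k0) ar; have := ler_wpM2l M0 (ler_wpM2l (ltW b10) ar).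
rewrite /iota /zeta; lra.
Qed.

End OnePointEstimates.

(** * The contraction *)

(** The final choice of Hairer and Mattingly, with t = omega(x) + omega(y).  For t
    above the threshold, beta (L - b) t exceeds 2 beta K by at least beta, which
    pays for 2 (1 - L) <= beta; below it, beta is so small that 2 beta K uses up
    only half of eps. *)
Lemma contraction_constants (R : realType) (b K eps : R) :
  0 < b < 1 -> 0 <= K -> 0 < eps ->
  exists beta L : R, [/\ 0 < beta < 1, 0 < L < 1 & forall t, 0 <= t ->
    2 - eps + beta * (b * t + 2 * K) <= L * (2 + beta * t) /\
    ((4 * K + 2) / (1 - b) <= t ->
     2 + beta * (b * t + 2 * K) <= L * (2 + beta * t))].
Proof.
move=> /andP[b0 b1] K0 e0.
pose beta := Num.min (1 / 2) (eps / (4 * K + 4)).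
have K4 : 0 < 4 * K + 4 by lra.
have beta0 : 0 < beta by rewrite /beta lt_min divr_gt0//= divr_gt0.
have beta1 : beta <= 1 / 2 by rewrite /beta ge_min lexx.
have betae : beta * (4 * K + 4) <= eps.
  by rewrite -ler_pdivlMr// /beta ge_min lexx orbT.
pose L := Num.max ((1 + b) / 2) (Num.max (1 - eps / 4) (1 - beta / 2)).
have L1 : (1 + b) / 2 <= L by rewrite /L le_max lexx.
have L2 : 1 - eps / 4 <= L by rewrite /L !le_max lexx orbT.
have L3 : 1 - beta / 2 <= L by rewrite /L !le_max lexx !orbT.
exists beta, L; split.
- by apply/andP; split; lra.
- apply/andP; split; first by lra.
  by rewrite /L !gt_max; apply/and3P; split; lra.
- move=> t t0.
  have bt : 0 <= beta * t by rewrite mulr_ge0// ltW.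
  have Lt : (1 + b) / 2 * (beta * t) <= L * (beta * t) by rewrite ler_wpM2r.
  split.
    have h : b * (beta * t) <= (1 + b) / 2 * (beta * t) by rewrite ler_wpM2r//; lra.
    have bK : 0 <= beta * K by rewrite mulr_ge0// ltW.
    by lra.
  rewrite ler_pdivrMr ?subr_gt0// => ht.
  have := ler_wpM2l (ltW beta0) ht.
  by lra.
Qed.

(** Differences of least upper bounds over the same options with the same costs:
    the costs cancel when the option that is nearly optimal for one function is
    used for the other.  The bounds r1, r2 enter only through their universal
    property, so no optimal option has to exist. *)
Lemma lub_cross (R : realType) (T : Type) (U : set T) (v1 v2 cx cy : T -> R)
    (x y : T) (r1x r2x r1y r2y D : R) :
  v1 x <= r1x -> (forall a, U a -> v1 a + cx a <= r1x) ->
  v2 y <= r2y -> (forall b, U b -> v2 b + cy b <= r2y) ->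
  (forall B, v2 x <= B -> (forall a, U a -> v2 a + cx a <= B) -> r2x <= B) ->
  (forall B, v1 y <= B -> (forall b, U b -> v1 b + cy b <= B) -> r1y <= B) ->
  (forall a b, a = x \/ U a -> b = y \/ U b ->
    v2 a - v1 a + v1 b - v2 b <= D) ->
  r2x - r1x + r1y - r2y <= D.
Proof.
move=> h1 h1U h2 h2U l2 l1 HD.
have key a k : a = x \/ U a -> v1 a + k <= r1x ->
    v2 a + k <= D + r1x + r2y - r1y.
  move=> ax ak; suff : r1y <= D + r1x + r2y - v2 a - k by lra.
  apply: l1 => [|b Ub].
    by have := HD a y ax (or_introl erefl); lra.
  by have := HD a b ax (or_intror Ub); have := h2U b Ub; lra.
suff : r2x <= D + r1x + r2y - r1y by lra.
apply: l2 => [|a Ua]; last by apply: key; [right|exact: h1U].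
by have := key x 0 (or_introl erefl); rewrite !addr0; apply.
Qed.

Lemma continuous_compact_bounded (R : realType) (T : topologicalType)
    (U : set T) (g : T -> R) : compact U -> continuous g ->
  exists2 B, 0 <= B & forall x, U x -> g x <= B.
Proof.
move=> cU cg.
have /compact_bounded [B [_ HB]] : compact (g @` U).
  by apply: continuous_compact => //; exact: continuous_subspaceT.
exists (Num.max B 0 + 1); first by rewrite addr_ge0// le_max lexx orbT.
move=> x Ux; apply: le_trans (ler_norm _) _.
apply: (HB (Num.max B 0 + 1)); last by exists x.
by apply: (@le_lt_trans _ _ (Num.max B 0)); rewrite ?le_max ?lexx// ltrDl.
Qed.

Theorem theorem3p2 (R : realType) (n : nat)
    (dW : measure_display) (W : measurableType dW)
    (F : R -> set (set W)) (X : R -> W -> 'rV[R]_n)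
    (P : 'rV[R]_n -> probability W R)
    (U : set 'rV[R]_n) (delta : R) (omega f : 'rV[R]_n -> R)
    (c : 'rV[R]_n -> 'rV[R]_n -> R) (gamma : R)
    (hX : feller_markov F X P)
    (hU : compact U)
    (hdelta : 0 < delta)
    (homega_cont : continuous omega)
    (homega_ge0 : forall x, 0 <= omega x)
    (hA1 : assumption_A1 omega f)
    (hA2 : assumption_A2 omega U c)
    (hA3 : assumption_A3 X P delta omega)
    (hA4 : assumption_A4 X P U delta omega)
    (hgamma : gamma < 0) :
  exists beta L : R -> R,
    (forall M : R, 0 <= M -> 0 < beta M < 1 /\ 0 < L M < 1) /\
    forall (M : R) (f1 f2 : 'rV[R]_n -> R), 0 <= M ->
      Cw omega f1 -> Cw omega f2 ->
      (wspan omega 1 (EFin \o f1) <= M%:E)%E ->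
      (wspan omega 1 (EFin \o f2) <= M%:E)%E ->
      (wspan omega (beta M)
         (fun x => T_op X P U delta f c gamma f1 x
                   - T_op X P U delta f c gamma f2 x)
       <= (L M)%:E * wspan omega (beta M) (fun x => (f1 x - f2 x)%:E))%E.
Proof.
have [C C0 hf] := Cw_bound _ homega_ge0 _ hA1.
have [cf _] := hA1.
have [_ [c0 c00 hc] _] := hA2.
have [b1 [M1 [M2 [b1P h3]]]] := hA3.
have mI l x := (h3 l x).1.
have mZ l x := (h3 l x).2.
have [KU KU0 hKU] := continuous_compact_bounded R _ U omega hU homega_cont.
pose b := (1 + b1) / 2.
have bP : 0 < b < 1 by move: b1P => /andP[? ?]; rewrite /b; apply/andP; split; lra.
suff main (M : R) : exists bL : R * R, 0 <= M ->
    [/\ 0 < bL.1 < 1, 0 < bL.2 < 1 & forall f1 f2 : 'rV[R]_n -> R,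
      Cw omega f1 -> Cw omega f2 ->
      (wspan omega 1 (EFin \o f1) <= M%:E)%E ->
      (wspan omega 1 (EFin \o f2) <= M%:E)%E ->
      (wspan omega bL.1
         (fun x => T_op X P U delta f c gamma f1 x
                   - T_op X P U delta f c gamma f2 x)
       <= bL.2%:E * wspan omega bL.1 (fun x => (f1 x - f2 x)%:E))%E].
  have [bL hbL] := choice main.
  exists (fun M => (bL M).1), (fun M => (bL M).2); split.
    by move=> M M0; have [] := hbL M M0.
  by move=> M f1 f2 M0; have [_ _] := hbL M M0; apply.
have [M0|M0] := leP 0 M; last by exists (0, 0).
have [K [eps [K0 eps0 cmp]]] := one_point_estimates delta omega f gamma C b1 M M1 M2
  hX hdelta homega_cont homega_ge0 cf C0 hf hgamma b1P M0 mI mZ.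
(* Shifting to U raises the weight by at most KU, which is absorbed in K. *)
pose K' := K + b * KU.
have K'0 : 0 <= K' by rewrite /K' addr_ge0// mulr_ge0//; case/andP: bP => /ltW.
pose r := (4 * K' + 2) / (1 - b) + KU.
have r0 : 0 < r.
  rewrite /r ltr_wpDr// divr_gt0//; first by lra.
  by case/andP: bP; lra.
have [d [nu [d0 _ hnu]]] := hA4 r r0.
(* One of two sets covering the space has nu-mass at least 1/2. *)
pose p := d / 2.
have p0 : 0 < p by rewrite divr_gt0.
have [beta [L [betaP LP bL]]] := contraction_constants R b K' (eps r p) bP K'0 (eps0 r p p0).
exists (beta, L) => _; split => // f1 f2 Cf1 Cf2 sp1 sp2 /=.
have /andP[beta0 _] := betaP.
have /andP[L0 _] := LP.
have [k1 hk1] := wspan_center _ homega_ge0 _ _ _ ler01 sp1.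
have [k2 hk2] := wspan_center _ homega_ge0 _ _ _ ler01 sp2.
have {}hk1 x : `|f1 x - k1| <= M * (1 + omega x) by have := hk1 x; rewrite mul1r.
have {}hk2 x : `|f2 x - k2| <= M * (1 + omega x) by have := hk2 x; rewrite mul1r.
have [cf1 _] := Cf1; have [cf2 _] := Cf2.
have sp0 := wspan_ge0 omega beta (fun x => f1 x - f2 x).
(* An infinite span on the right makes the inequality trivial. *)
case E : (wspan omega beta (fun x => (f1 x - f2 x)%:E)) => [s| |]; last 2 first.
- by rewrite gt0_muley ?lte_fin// leey.
- by move: sp0; rewrite /comp E.
have s0 : 0 <= s by rewrite -lee_fin -E.
have Es : (wspan omega beta (EFin \o (fun x => (f1 x - f2 x)%R)) <= s%:E)%E.
  by rewrite /comp E.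
have [kap hkap] := wspan_center _ homega_ge0 _ _ _ (ltW beta0) Es.
have hup x : f1 x - f2 x - kap <= s * (1 + beta * omega x).
  by have := hkap x; rewrite ler_norml => /andP[].
have hlo x : f2 x - f1 x - (- kap) <= s * (1 + beta * omega x).
  by have := hkap x; rewrite ler_norml => /andP[h _]; lra.
pose V g a := log_mgf X P delta f gamma g a.
have EV1 a := entropic_log_mgf delta omega f gamma C b1 M M1 M2
  hX hdelta homega_cont homega_ge0 cf C0 hf hgamma M0 mI mZ f1 k1 a cf1 hk1.
have EV2 a := entropic_log_mgf delta omega f gamma C b1 M M1 M2
  hX hdelta homega_cont homega_ge0 cf C0 hf hgamma M0 mI mZ f2 k2 a cf2 hk2.
have [q1 hq1] := log_mgf_lower_bound delta omega f gamma C b1 M M1 M2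
  hX hdelta homega_cont homega_ge0 cf C0 hf hgamma b1P M0 mI mZ f1 k1 KU cf1 hk1.
have [q2 hq2] := log_mgf_lower_bound delta omega f gamma C b1 M M1 M2
  hX hdelta homega_cont homega_ge0 cf C0 hf hgamma b1P M0 mI mZ f2 k2 KU cf2 hk2.
have ub (q v : R) : q <= v -> v / gamma <= q / gamma.
  by move=> qv; rewrite ler_nM2r// invr_lt0.
have lub1 x := R_op_lub X P U delta f c gamma (fun y => f1 y / gamma)
  (fun y => V f1 y / gamma) (q1 / gamma) x EV1
  (fun xi Uxi => ub _ _ (hq1 xi (hKU xi Uxi)))
  (fun xi Uxi => le_trans (hc x xi Uxi) (ltW c00)).
have lub2 x := R_op_lub X P U delta f c gamma (fun y => f2 y / gamma)
  (fun y => V f2 y / gamma) (q2 / gamma) x EV2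
  (fun xi Uxi => ub _ _ (hq2 xi (hKU xi Uxi)))
  (fun xi Uxi => le_trans (hc x xi Uxi) (ltW c00)).
rewrite -EFinM; apply: ge_ereal_sup => _ [[x y] _ <-] /=.
have [r1x [E1x h1x h1xU _]] := lub1 x.
have [r2x [E2x _ _ l2x]] := lub2 x.
have [r1y [E1y _ _ l1y]] := lub1 y.
have [r2y [E2y h2y h2yU _]] := lub2 y.
rewrite /T_op E1x E2x E1y E2y -!EFinM lee_fin.
rewrite ler_pdivrMr; last by apply: weight2_gt0 => //; exact: ltW.
have g0 : 0 < - gamma by rewrite oppr_gt0.
set Wt := 2 + beta * omega x + beta * omega y.
suff H : r2x - r1x + r1y - r2y <= L * s * Wt / (- gamma).
  by move: H; rewrite ler_pdivlMr//; lra.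
apply: (lub_cross R 'rV[R]_n U (fun y => V f1 y / gamma) (fun y => V f2 y / gamma)
  (c x) (c y) x y) => // a e ax ey.
rewrite ler_pdivlMr//.
have -> : (V f2 a / gamma - V f1 a / gamma + V f1 e / gamma - V f2 e / gamma) * - gamma
   = V f1 a - V f2 a + (V f2 e - V f1 e) by field; rewrite lt_eqF.
have ax' : omega a <= omega x + KU.
  by case: ax => [->|/hKU h]; [rewrite lerDl|rewrite (le_trans h)// lerDr].
have ey' : omega e <= omega y + KU.
  by case: ey => [->|/hKU h]; [rewrite lerDl|rewrite (le_trans h)// lerDr].
pose t := omega x + omega y.
have t0 : 0 <= t by rewrite addr_ge0.
have [up1 up2] := cmp f1 f2 k1 k2 kap s beta a cf1 hk1 cf2 hk2 s0 (ltW beta0) hup.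
have [lo1 lo2] := cmp f2 f1 k2 k1 (- kap) s beta e cf2 hk2 cf1 hk1 s0 (ltW beta0) hlo.
have [bL1 bL2] := bL t t0.
have be : beta * ((b * omega a + K) + (b * omega e + K)) <= beta * (b * t + 2 * K').
  rewrite ler_pM2l// /K' /t.
  have b0 : 0 <= b by case/andP: bP => /ltW.
  have := ler_wpM2l b0 ax'; have := ler_wpM2l b0 ey'; lra.
have fin (u : R) : u + beta * (b * t + 2 * K') <= L * (2 + beta * t) ->
    s * (u + beta * ((b * omega a + K) + (b * omega e + K))) <= L * s * Wt.
  move=> hu; have -> : L * s * Wt = s * (L * (2 + beta * t)) by rewrite /Wt /t; ring.
  by apply: ler_wpM2l => //; apply: le_trans hu; rewrite lerD2l.
(* Far out the drift suffices, without any gain. *)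
have [tr|tr] := leP ((4 * K' + 2) / (1 - b)) t.
  have := fin _ (bL2 tr); move: up1 lo1; rewrite /V -/b; lra.
have ar : omega a <= r.
  by apply: (le_trans ax'); rewrite /r lerD2r (le_trans _ (ltW tr))// /t lerDl.
have er : omega e <= r.
  by apply: (le_trans ey'); rewrite /r lerD2r (le_trans _ (ltW tr))// /t lerDr.
have hf' := fin _ bL1.
(* The gain occurs at a if f1 - f2 - kap is often nonpositive under nu, and at e
   if it is often nonnegative. *)
pose A : set (borelRn R n) := [set z | f1 z - f2 z <= kap].
pose B : set (borelRn R n) := [set z | f2 z - f1 z <= - kap].
have mA : measurable A by exact: measurable_sublevel.
have mB : measurable B by exact: measurable_sublevel.
have AB : A `|` B = setT.
  apply/seteqP; split => // z _; rewrite /A /B /=.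
  by have [h|h] := leP (f1 z - f2 z) kap; [left|right; lra].
have minor (D : set (borelRn R n)) w : measurable D -> ((1 / 2)%:E <= nu D)%E -> omega w <= r ->
    (p%:E <= P w (X delta @^-1` D))%E.
  move=> mD hD wr; apply: (@le_trans _ _ (d%:E * nu D)%E).
    have -> : p%:E = (d%:E * (1 / 2)%:E)%E by rewrite -EFinM /p mul1r.
    by rewrite lee_pmul2l// lte_fin.
  by apply: (le_trans (hnu D mD)); apply: ereal_inf_lbound; exists w.
have [hA|hA] := leP (1 / 2)%:E (nu A).
  have := up2 r p p0 ar (minor A a mA hA ar).
  move: lo1 hf'; rewrite /V -/b; lra.
have hB : ((1 / 2)%:E <= nu B)%E.
  rewrite leNgt; apply/negP => hB.
  have : (1 <= nu A + nu B)%E.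
    by rewrite -(probability_setT nu) -AB; exact: measureU2.
  by apply/negP; rewrite -ltNge; have := lteD hA hB; rewrite -EFinD -splitr.
have := lo2 r p p0 er (minor B e mB hB er).
move: up1 hf'; rewrite /V -/b; lra.
Qed.
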